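(* Let $\mathcal B$ be a pointed $T_0$ semitopological barycentric algebra. For $\alpha\in{]0,1[}$ let $\eta^{\alpha}\colon\mathcal B\to\mathrm{tscope}_\alpha(\mathcal B)$ be the map $x\mapsto[(0,x)]_\alpha$. The following are equivalent: 1. $\mathcal B$ is strictly embeddable, i.e. there is a linear topological embedding of $\mathcal B$ in some semitopological cone; 2. $\eta^\alpha$ is a topological embedding for every $\alpha\in{]0,1[}$; 3. $\eta^\alpha$ is a topological embedding for some $\alpha\in{]0,1[}$; 4. the proper open subsets of $\mathcal B$ are exactly the sets $h^{-1}(]1,\infty])$ where $h$ ranges over the $\mathbb I$-homogeneous lower semicontinuous maps from $\mathcal B$ to $\overline{\mathbb R}_+$; 5. the sets $h^{-1}(]1,\infty])$, where $h$ ranges over the $\mathbb I$-homogeneous lower semicontinuous maps from $\mathcal B$ to $\overline{\mathbb R}_+$, form a subbase of the topology of $\mathcal B$; 6. the map $\alpha\cdot\_\colon\mathcal B\to\mathcal B$ is full for every $\alpha\in{]0,1[}$; 7. the map $\alpha\cdot\_\colon\mathcal B\to\mathcal B$ is full for some $\alpha\in{]0,1[}$.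
   Context: $\mathbb R_+=[0,\infty[$ and $\overline{\mathbb R}_+=\mathbb R_+\cup\{\infty\}$ (with $0\cdot\infty=0$) carry the Scott topology (open sets $\{t:t>a\}$, the whole set, $\emptyset$); lower semicontinuous means continuous into $\overline{\mathbb R}_+$ with this topology. A cone is a commutative monoid $(\mathfrak C,+,0)$ with an action of $\mathbb R_+$ satisfying $0\cdot x=0$, $(ab)\cdot x=a\cdot(b\cdot x)$, $1\cdot x=x$, $a\cdot0=0$, $a\cdot(x+y)=a\cdot x+a\cdot y$, $(a+b)\cdot x=a\cdot x+b\cdot x$; it is semitopological if it has a topology making $+$ and $\cdot$ separately continuous. A barycentric algebra is a set $\mathcal B$ with operations $+_a$, $a\in[0,1]$, such that $x+_1y=x$, $x+_ax=x$, $x+_ay=y+_{1-a}x$, $(x+_ay)+_bz=x+_{ab}(y+_{\frac{(1-a)b}{1-ab}}z)$ if $a,b<1$. Cones are barycentric algebras with $x+_ay=a\cdot x+(1-a)\cdot y$. It is semitopological if it has a topology making $(x,a,y)\mapsto x+_ay$ separately continuous, $[0,1]$ having its metric topology. A pointed semitopological barycentric algebra is a semitopological barycentric algebra with a distinguished element $\bot$ that is least in the specialization preordering ($x\le y$ iff every open neighborhood of $x$ contains $y$); $a\cdot x$ denotes $x+_a\bot$ for $a\in[0,1]$. A semitopological cone is pointed with $\bot=0$. A map $f$ is $\mathbb I$-homogeneous if $f(a\cdot x)=a\cdot f(x)$ for all $a\in[0,1]$; affine if $f(x+_ay)=f(x)+_af(y)$; linear if $\mathbb I$-homogeneous and affine.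 A map $f\colon Y\to Z$ between spaces is full if every open subset of $Y$ is of the form $f^{-1}(V)$ with $V$ open in $Z$; a topological embedding is an injective full continuous map. An open subset is proper if it is not the whole space. $\mathrm{tscope}_\alpha(\mathcal B)$ is the quotient of $\coprod_{n\in\mathbb N}\mathcal B$ (pairs $(n,x)$) by the smallest equivalence relation such that $(n,x)\equiv_\alpha(n+1,\alpha\cdot x)$, with the quotient topology of the coproduct topology; $[(n,x)]_\alpha$ is the class of $(n,x)$. It is a semitopological cone with zero $[(0,\bot)]_\alpha$, $a\cdot[(n,x)]_\alpha=[(n+k,(\alpha^ka)\cdot x)]_\alpha$ for any $k$ with $\alpha^ka\le1$, and $[(n,x)]_\alpha+[(n,y)]_\alpha=2\cdot[(n,x+_{1/2}y)]_\alpha$. *)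

(* Defs.v *)
From HB Require Import structures.
From mathcomp Require Import all_boot all_order all_algebra.
From mathcomp Require Import interval_inference.
From mathcomp Require Import all_classical all_reals topology ereal convex.

Set Implicit Arguments.
Unset Strict Implicit.
Unset Printing Implicit Defensive.

Import Order.TTheory GRing.Theory Num.Theory.
Import numFieldTopology.Exports.

Local Open Scope classical_set_scope.
Local Open Scope ring_scope.
Local Open Scope convex_scope.
Local Open Scope quotient_scope.

Section Scott.
Context {d} (T : orderType d).

Definition scott_open : set_system T :=
  [set U | [\/ U = set0, U = setT | exists a, U = [set t | (a < t)%O]]].

Lemma scott_openT : scott_open setT.
Proof. by constructor 2. Qed.

Lemma scott_openI : setI_closed scott_open.
Proof.
move=> U V [->|->|[a ->]]; rewrite ?set0I ?setTI//; first by constructor 1.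
move=> [->|->|[b ->]]; rewrite ?setI0 ?setIT; first by constructor 1.
  by constructor 3; exists a.
constructor 3; exists (Order.max a b); apply/seteqP; split=> t /=.
  by move=> [at_ bt]; rewrite gt_max at_ bt.
by rewrite gt_max => /andP[].
Qed.

Hypothesis has_glb : forall A : set T, A !=set0 ->
  exists m, forall t, (m < t)%O <-> exists2 a, A a & (a < t)%O.

Lemma scott_open_bigcup (I : Type) (f : I -> set T) :
  (forall i, scott_open (f i)) -> scott_open (\bigcup_i f i).
Proof.
move=> fo.
have [[i fiT]|nT] := pselect (exists i, f i = setT).
  by constructor 2; apply/seteqP; split=> // t _; exists i => //; rewrite fiT.
pose A := [set a | exists i, f i = [set t | (a < t)%O]].
have [A0|/nonemptyPn A0] := pselect (A !=set0); last first.
  constructor 1; apply/seteqP; split=> // t [i _].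
  case: (fo i) => [->//|fiT|[a fia]]; first by case: nT; exists i.
  by have : A a by [exists i]; rewrite A0.
have [m mP] := has_glb A0; constructor 3; exists m.
apply/seteqP; split=> t /=.
  move=> [i _]; case: (fo i) => [->//|fiT|[a fia]]; first by case: nT; exists i.
  by rewrite fia /= => at_; apply/mP; exists a => //; exists i.
by move=> /mP[a [i fia] at_]; exists i; rewrite ?fia.
Qed.

End Scott.

(* The topology of Rplus is the Scott topology, not the metric one. *)
Record Rplus (R : realType) : Type := MkRplus {
  Rplus_val :> R ;
  Rplus_nneg : Rplus_val \is Num.nneg }.

Section Rplus.
Context (R : realType).

HB.instance Definition _ := [isSub for @Rplus_val R].
HB.instance Definition _ := [Choice of Rplus R by <:].
HB.instance Definition _ := [SubChoice_isSubComNzSemiRing of Rplus R by <:].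
HB.instance Definition _ := 
  [SubChoice_isSubOrder of Rplus R by <: with ring_display].

Lemma Rplus_has_glb (A : set (Rplus R)) : A !=set0 ->
  exists m : Rplus R, forall t, (m < t)%O <-> exists2 a, A a & (a < t)%O.
Proof.
move=> [a0 Aa0]; pose B : set R := [set Rplus_val a | a in A].
have B0 : B !=set0 by exists a0; exists a0.
have lbB : lbound B 0 by move=> _ [a _ <-]; have := Rplus_nneg a; rewrite nnegrE.
have infB : inf B \is Num.nneg by rewrite nnegrE; apply: lb_le_inf.
exists (MkRplus infB) => t; split.
  move=> /(inf_lt B0)[_ [a Aa <-]] at_.
  by exists a.
move=> [a Aa at_]; apply: le_lt_trans at_.
by apply: ge_inf; [exists 0|exists a].
Qed.

HB.instance Definition _ := isOpenTopological.Build (Rplus R)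
  (@scott_openT _ (Rplus R)) (@scott_openI _ (Rplus R))
  (@scott_open_bigcup _ (Rplus R) Rplus_has_glb).

Lemma i01_nneg (a : {i01 R}) : a%:num \is Num.nneg.
Proof. by rewrite nnegrE. Qed.

Definition Rplus_of_i01 (a : {i01 R}) : Rplus R := MkRplus (i01_nneg a).

End Rplus.

Record ERplus (R : realType) : Type := MkERplus {
  ERplus_val :> \bar R ;
  ERplus_ge0 : (0 <= ERplus_val)%E }.

Section ERplus.
Context (R : realType).

HB.instance Definition _ := [isSub for @ERplus_val R].
HB.instance Definition _ := [Choice of ERplus R by <:].
HB.instance Definition _ := 
  [SubChoice_isSubOrder of ERplus R by <: with ereal_display].

Lemma ERplus_has_glb (A : set (ERplus R)) : A !=set0 ->
  exists m : ERplus R, forall t, (m < t)%O <-> exists2 a, A a & (a < t)%O.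
Proof.
move=> [a0 Aa0]; pose B : set (\bar R) := [set ERplus_val a | a in A].
have infB : (0 <= ereal_inf B)%E.
  by apply: le_ereal_inf_tmp => _ [a _ <-]; exact: ERplus_ge0.
exists (MkERplus infB) => t; split.
  by move=> /ereal_inf_lt[_ [a Aa <-]] at_; exists a.
move=> [a Aa at_]; apply: le_lt_trans at_.
by apply: ereal_inf_lbound; exists a.
Qed.

HB.instance Definition _ := isOpenTopological.Build (ERplus R)
  (@scott_openT _ (ERplus R)) (@scott_openI _ (ERplus R))
  (@scott_open_bigcup _ (ERplus R) ERplus_has_glb).

Definition ERplus0 : ERplus R := MkERplus (lexx 0%E).

Definition ERplus_add (x y : ERplus R) : ERplus R :=
  MkERplus (adde_ge0 (ERplus_ge0 x) (ERplus_ge0 y)).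

Lemma Rplus_ge0E (a : Rplus R) : (0 <= (a : R)%:E)%E.
Proof. by rewrite lee_fin -nnegrE; exact: Rplus_nneg. Qed.

(* 0 * +oo = 0 holds for the multiplication of \bar R. *)
Definition ERplus_scale (a : Rplus R) (x : ERplus R) : ERplus R :=
  MkERplus (mule_ge0 (Rplus_ge0E a) (ERplus_ge0 x)).

Let addA : associative ERplus_add.
Proof. by move=> x y z; apply/val_inj; exact: addeA. Qed.
Let addC : commutative ERplus_add.
Proof. by move=> x y; apply/val_inj; exact: addeC. Qed.
Let add0 : left_id ERplus0 ERplus_add.
Proof. by move=> x; apply/val_inj; exact: add0e. Qed.

HB.instance Definition _ := GRing.isNmodule.Build (ERplus R) addA addC add0.

Let scaleA a b x : ERplus_scale a (ERplus_scale b x) = ERplus_scale (a * b) x.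
Proof. by apply/val_inj => /=; rewrite EFinM muleA. Qed.
Let scale0 x : ERplus_scale 0 x = 0.
Proof. by apply/val_inj => /=; rewrite mul0e. Qed.
Let scale1 : left_id 1 ERplus_scale.
Proof. by move=> x; apply/val_inj => /=; rewrite mul1e. Qed.
Let scaleDr : right_distributive ERplus_scale +%R.
Proof.
by move=> a x y; apply/val_inj => /=; rewrite ge0_muleDr ?ERplus_ge0.
Qed.
Let scaleDl x : {morph ERplus_scale^~ x : a b / a + b}.
Proof.
by move=> a b; apply/val_inj => /=; rewrite EFinD ge0_muleDl ?Rplus_ge0E.
Qed.

HB.instance Definition _ := GRing.Nmodule_isLSemiModule.Build (Rplus R)
  (ERplus R) scaleA scale0 scale1 scaleDr scaleDl.

End ERplus.

Definition specialization_le (T : topologicalType) (x y : T) : Prop :=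
  forall U : set T, open U -> U x -> U y.

(* [0, 1] with its metric topology, as a subspace of R *)
Definition unit_interval (R : realType) : Type :=
  initial_topology (fun a : {i01 R} => a%:num : R).
HB.instance Definition _ (R : realType) := Topological.on (unit_interval R).

(* Barycentric algebras are convType's, x +_a y being x <| a |> y; convA
   is the axiom (x +_a y) +_b z = x +_(ab) (y +_((1-a)b/(1-ab)) z) freed of its
   division. *)
HB.mixin Record isSemitopologicalBarycentric (R : realType) T
    & Topological T & ConvexSpace R T := {
  conv_continuous_l : forall (a : {i01 R}) (y : T),
    continuous (fun x : T => x <| a |> y) ;
  conv_continuous_coef : forall x y : T,
    continuous ((fun a : {i01 R} => x <| a |> y) : unit_interval R -> T) ;
  conv_continuous_r : forall (a : {i01 R}) (x : T),
    continuous (fun y : T => x <| a |> y) }.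

#[short(type=semitopBaryType)]
HB.structure Definition SemitopBary (R : realType) :=
  {T of Topological T & ConvexSpace R T & isSemitopologicalBarycentric R T}.

HB.mixin Record hasLeastPoint (R : realType) T & SemitopBary R T := {
  bary_bot : T ;
  bary_bot_le : forall x : T, specialization_le bary_bot x }.

#[short(type=pointedSemitopBaryType)]
HB.structure Definition PointedSemitopBary (R : realType) :=
  {T of SemitopBary R T & hasLeastPoint R T}.

(* Cones are semimodules over the semiring Rplus R; a *: 0 = 0 follows from
   scalerA and scale0r. *)
HB.mixin Record isSemitopologicalCone (R : realType) T
    & Topological T & GRing.LSemiModule (Rplus R) T := {
  cone_add_continuous : forall x : T, continuous (fun y : T => x + y) ;
  cone_scale_continuous_l : forall x : T,
    continuous (fun a : Rplus R => a *: x) ;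
  cone_scale_continuous_r : forall a : Rplus R,
    continuous (fun x : T => a *: x) }.

#[short(type=semitopConeType)]
HB.structure Definition SemitopCone (R : realType) :=
  {T of Topological T & GRing.LSemiModule (Rplus R) T
      & isSemitopologicalCone R T}.

Section Maps.
Context (R : realType) (B : pointedSemitopBaryType R).

Definition bary_scale (a : {i01 R}) (x : B) : B := x <| a |> bary_bot.

Section IntoCone.
Context (C : lSemiModType (Rplus R)).

Definition Ihomogeneous (f : B -> C) : Prop :=
  forall a x, f (bary_scale a x) = Rplus_of_i01 a *: f x.

(* A cone is a barycentric algebra with x +_a y = a x + (1 - a) y. *)
Definition affine_map (f : B -> C) : Prop :=
  forall (a : {i01 R}) (x y : B),
    f (x <| a |> y) =
      Rplus_of_i01 a *: f x + Rplus_of_i01 (1 - a%:num)%:i01 *: f y.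

Definition linear_map (f : B -> C) : Prop := Ihomogeneous f /\ affine_map f.

End IntoCone.

Definition full (Y Z : topologicalType) (f : Y -> Z) : Prop :=
  forall U : set Y, open U -> exists2 V : set Z, open V & U = f @^-1` V.

Definition topological_embedding (Y Z : topologicalType) (f : Y -> Z) : Prop :=
  [/\ injective f, full f & continuous f].

Definition strictly_embeddable : Prop :=
  exists (C : semitopConeType R) (f : B -> C),
    linear_map f /\ topological_embedding f.

Definition homogeneous_superlevels : set_system B :=
  [set h @^-1` [set t : ERplus R | (1 < t :> \bar R)%E] |
    h in [set h : B -> ERplus R | Ihomogeneous h /\ continuous h]].

End Maps.

(* The empty intersection, i.e. the whole space, is among the finite
   intersections. *)
Definition is_subbase (T : topologicalType) (F : set_system T) : Prop :=
  forall U : set T, open U <->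
    exists2 G : set_system T, G `<=` finI_from F id & U = \bigcup_(V in G) V.

Section Tscope.
Context (R : realType) (B : pointedSemitopBaryType R) (alpha : {i01 R}).

Definition tscope_pre : Type := {n : nat & B}.
HB.instance Definition _ := Topological.on tscope_pre.

Inductive tscope_equiv : tscope_pre -> tscope_pre -> Prop :=
| tscope_step n x :
    tscope_equiv (existT _ n x) (existT _ n.+1 (bary_scale alpha x))
| tscope_refl u : tscope_equiv u u
| tscope_sym u v : tscope_equiv u v -> tscope_equiv v u
| tscope_trans u v w :
    tscope_equiv u v -> tscope_equiv v w -> tscope_equiv u w.

Definition tscope_eqb : rel tscope_pre := fun u v => `[< tscope_equiv u v >].

Lemma tscope_eqb_refl : reflexive tscope_eqb.
Proof. by move=> u; apply/asboolP; exact: tscope_refl. Qed.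

Lemma tscope_eqb_sym : symmetric tscope_eqb.
Proof. by move=> u v; apply/asboolP/asboolP; exact: tscope_sym. Qed.

Lemma tscope_eqb_trans : transitive tscope_eqb.
Proof.
by move=> v u w /asboolP uv /asboolP vw; apply/asboolP; exact: tscope_trans vw.
Qed.

Canonical tscope_equiv_rel :=
  EquivRel tscope_eqb tscope_eqb_refl tscope_eqb_sym tscope_eqb_trans.

Definition tscope : topologicalType :=
  quotient_topology {eq_quot tscope_equiv_rel}.

Definition tscope_class (u : tscope_pre) : tscope :=
  \pi_(quotient_topology {eq_quot tscope_equiv_rel}) u.

Definition eta (x : B) : tscope := tscope_class (existT _ 0%N x).

End Tscope.

Arguments bary_scale {R} B a x.
Arguments homogeneous_superlevels {R} B.
Arguments eta {R} B alpha x.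

(* Main.v *)
From HB Require Import structures.
Require Import Defs.
From mathcomp Require Import all_boot all_order all_algebra.
From mathcomp Require Import interval_inference finmap ring lra.
From mathcomp Require Import all_classical all_reals topology ereal convex.
Import Order.TTheory GRing.Theory Num.Theory.
Import numFieldTopology.Exports.
Local Open Scope classical_set_scope.
Local Open Scope ring_scope.
Local Open Scope convex_scope.
Local Open Scope quotient_scope.

(** The property behind all the conditions is that open sets of B can be scaled
    up: for each open U and each r > 1 there should be an open set that contains
    x / r exactly when U contains x, even though B only has room for scaling
    points down.

    If B sits in a cone, multiplication by 1 / alpha in the cone performs this
    scaling, so dilation by alpha is full ([strictly_embeddable_full]).
    Conversely, suppose that dilation by a single alpha is full. Iterating the
    choice of an open set of which a given one is the inverse image gives a
    tower, i.e. open sets V n with V 0 = U, where V n is the inverse image of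
    V n.+1 under dilation ([full_tower]). A tower is the same thing as an open
    set of the telescope, so fullness of the dilation and fullness of eta are
    equivalent ([eta_embedding], [full_eta]), injectivity being a consequence of
    T0. A tower also tells for which x the multiple r x should belong to U, for
    every real r >= 0 ([level]). If U is proper, the supremum of the 1 / r over
    the r for which it does is an I-homogeneous lower semicontinuous function of
    x, whose superlevel at 1 is U ([gauge_superlevel]). Since such functions commute with
    dilations, their superlevels are inverse images under dilations, and if they
    form a subbase then all dilations are full ([superlevel_subbase_full]).

    There remains to embed B in a cone when its proper open sets are the
    superlevels of homogeneous functions. The cone consists of formal multiples
    (r, x) with (r, x) + (s, y) = (r + s, x <| r / (r + s) |> y), modulo adding
    multiples of the least point. It carries the quotient topology of the
    coproduct of copies of B indexed by r. The addition is then commutative and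
    associative by the barycentric axioms, and separate continuity can be
    checked on the slices. A homogeneous function h extends to this cone by
    r h(x), so that x |-> (1, x) is full ([superlevels_embeddable]). *)

Set Implicit Arguments.
Unset Strict Implicit.
Unset Printing Implicit Defensive.

(** * Subbases and Scott topologies *)

Lemma finI_from_open (T : topologicalType) (F : set_system T) :
  F `<=` open -> finI_from F id `<=` open.
Proof.
move=> Fo _ [D /= DF <-]; rewrite openE => x Dx.
apply: filter_bigI => U UD; apply: open_nbhs_nbhs; split; last exact: Dx.
by apply: Fo; have := DF U UD; rewrite inE.
Qed.

(** Fullness of f says that the topology of T is coarser than the initial
    topology of f, and a coarser topology need only be tested on a subbase. *)
Lemma full_subbase (T S : topologicalType) (F : set_system T) (f : T -> S) :
    is_subbase F -> (forall U, F U -> exists2 V, open V & U = f @^-1` V) ->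
  full f.
Proof.
move=> Fsub Ff U /Fsub[G GF ->].
suff [V oV fV] : open (\bigcup_(V in G) V : set (initial_topology f)).
  by exists V.
apply: bigcup_open => V /GF.
apply: (@finI_from_open (initial_topology f)) => W /Ff[W' oW' ->].
by exists W'.
Qed.

Lemma T0_eq (T : topologicalType) (x y : T) :
  kolmogorov_space T -> (forall U, open U -> U x <-> U y) -> x = y.
Proof.
move=> T0 xy; apply: contrapT => /eqP /T0[A]; rewrite !inE.
rewrite !nbhsE => -[[[U [oU Uz] UA] nA]|[[U [oU Uz] UA] nA]].
  by apply/nA/UA/(xy U oU).
by apply/nA/UA/(xy U oU).
Qed.

(** A quotient of a coproduct carries the final topology of the maps from the
    summands; both the telescope and the cone below are such quotients. *)
Lemma open_slice (I : choiceType) (X : I -> topologicalType)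
    (Q : quotType {i & X i}) (U : set (quotient_topology Q)) :
  open U <->
  forall i, open [set x : X i | U (\pi_(quotient_topology Q) (existT X i x))].
Proof.
split=> [oU i|oU].
  exact: (sigT_openP ((\pi_(quotient_topology Q) : {i & X i} -> _) @^-1` U)).1.
exact: (sigT_openP ((\pi_(quotient_topology Q) : {i & X i} -> _) @^-1` U)).2.
Qed.

Section ScottContinuity.
Context (R : realType).

Lemma Rplus_ge0 (r : Rplus R) : 0 <= (r : R).
Proof. by rewrite -nnegrE; exact: Rplus_nneg. Qed.

Lemma Rplus_neq0 (r : Rplus R) : r != 0 -> (r : R) != 0.
Proof. by apply: contra_neq => r0; apply/val_inj. Qed.

Lemma Rplus_gt0 (r : Rplus R) : r != 0 -> 0 < (r : R).
Proof. by move=> /Rplus_neq0; rewrite lt_neqAle eq_sym Rplus_ge0 andbT. Qed.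

Lemma Rplus_ltE (r s : Rplus R) : (r < s)%O = ((r : R) < (s : R)).
Proof. by []. Qed.

Lemma ERplus_ltE (s t : ERplus R) : (s < t)%O = (s < t :> \bar R)%E.
Proof. by []. Qed.

Lemma ERplus_eq (s t : ERplus R) :
  (forall c : R, 0 < c -> (c%:E < s)%E <-> (c%:E < t)%E) -> s = t.
Proof.
have dense (u v : ERplus R) : (u < v :> \bar R)%E ->
    exists2 c : R, 0 < c & (u <= c%:E < v)%E.
  case: u v => [[u||] u0] [[v||] v0] //=.
    rewrite lte_fin => uv; exists ((u + v) / 2); rewrite ?lee_fin ?lte_fin.
      by rewrite lee_fin in u0; lra.
    by apply/andP; split; lra.
  by exists (u + 1); rewrite ?ltry ?lee_fin ?andbT ?lerDl// ltr_wpDl.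
move=> st; apply/val_inj/eqP; rewrite eq_le !leNgt; apply/andP.
split; apply/negP => /dense[c c0 /andP[tc cs]];
  by move: cs => /st-/(_ c0); rewrite ltNge tc.
Qed.

(** The open set ]0, oo] is the union of the sets ]c, oo] over c > 0, and
    ]oo, oo] is empty, so positive real thresholds suffice. *)
Lemma continuous_ERplus (T : topologicalType) (h : T -> ERplus R) :
  (forall c : R, 0 < c -> open [set x | (c%:E < h x :> \bar R)%E]) ->
  continuous h.
Proof.
move=> ho; apply/continuousP => U [->|->|[a ->]].
- by rewrite preimage_set0; exact: open0.
- by rewrite preimage_setT; exact: openT.
case: a => -[c||] a0 /=.
- have [c0|c0] := ltP 0 c; first exact: ho.
  have pos (t : \bar R) : (0 < t)%E -> exists2 d, 0 < d & (d%:E < t)%E.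
    case: t => [t||]//=; last by exists 1; rewrite ?ltr01 ?ltry.
    rewrite lte_fin => t0; exists (t / 2); rewrite ?divr_gt0//.
    by rewrite lte_fin ltr_pdivrMr// ltr_pMr// ltr1n.
  have -> : h @^-1` [set t : ERplus R | (MkERplus a0 < t)%O] =
      \bigcup_(d in [set d : R | 0 < d]) [set x | (d%:E < h x :> \bar R)%E].
    have -> : MkERplus a0 = ERplus0 R.
      by apply/val_inj => /=; congr (_%:E); apply/le_anti; rewrite c0 -lee_fin.
    apply/seteqP; split=> x /=.
      by rewrite ERplus_ltE => /pos[d d0 dh]; exists d.
    move=> [d /= d0] dh; rewrite ERplus_ltE; apply: (@lt_trans _ _ d%:E) => //.
  exact: bigcup_open.
- rewrite [X in open X](_ : _ = set0); first exact: open0.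
  by apply/seteqP; split=> x //=; rewrite ERplus_ltE [(_ < _)%O]ltNge leey.
- by [].
Qed.

Lemma open_superlevel (T : topologicalType) (h : T -> ERplus R) (c : R) :
  continuous h -> 0 <= c -> open [set x | (c%:E < h x :> \bar R)%E].
Proof.
rewrite -lee_fin => /continuousP hc c0.
apply: (hc [set t | (MkERplus c0 < t)%O]).
by constructor 3; exists (MkERplus c0).
Qed.

(** The three conditions are those met by the inverse image of an open set
    under a |-> a z in a cone: 0 is least, scaling is increasing, and a can be
    slightly decreased. *)
Lemma open_Rplus_upset (S : set (Rplus R)) :
    (S 0 -> S = setT) -> (forall a b : Rplus R, S a -> (a <= b)%O -> S b) ->
    (forall a : Rplus R, S a -> a != 0 -> exists2 b, S b & (b < a)%O) ->
  open S.
Proof.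
move=> S0 Sup Sdown; have [/S0->|nS0] := pselect (S 0); first exact: openT.
have -> : S = \bigcup_(a in S) [set t | (a < t)%O].
  apply/seteqP; split=> [a Sa|b [a Sa /ltW]]; last exact: Sup.
  have [|b Sb ba] := Sdown a Sa; last by exists b.
  by apply: contra_notN nS0 => /eqP <-.
by apply: bigcup_open => a _; constructor 3; exists a.
Qed.
End ScottContinuity.

(** * Dilations of a pointed barycentric algebra *)

Section Dilations.
Context (R : realType) (B : pointedSemitopBaryType R).
Implicit Types (a b c : {i01 R}) (x y : B) (U V : set B).
Local Notation "'bot" := (@bary_bot R B).
Local Notation "a '.: x" := (bary_scale B a x) (at level 40).

Lemma bary_scale1 x : 1%:i01 '.: x = x. Proof. exact: conv1. Qed.
Lemma bary_scale0 x : 0%:i01 '.: x = 'bot. Proof. exact: conv0. Qed.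

(** Both sides combine x with the least point. Quasi-associativity collects the
    two copies of the least point into one, with weight q, as soon as c < 1; at
    c = 1 the weight q would be 0 / 0, but then a = b = 1. *)
Lemma bary_scaleM a b c x :
  c%:num = a%:num * b%:num -> a '.: (b '.: x) = c '.: x.
Proof.
move=> cE; rewrite /bary_scale.
have [c1|c1] := eqVneq c%:num 1.
  have a1 : a%:num = 1.
    apply/eqP; rewrite eq_le le1 /= -c1 cE.
    by rewrite ler_piMr.
  have b1 : b%:num = 1 by move: c1; rewrite cE a1 mul1r.
  have -> : a = 1%:i01 by apply/val_inj.
  have -> : b = 1%:i01 by apply/val_inj.
  have -> : c = 1%:i01 by apply/val_inj.
  by rewrite !conv1.
have c1' : 0 < 1 - c%:num by rewrite subr_gt0 lt_neqAle c1 le1.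
have ca : c%:num <= a%:num by rewrite cE ler_piMr.
pose q := 1 - (1 - a%:num) / (1 - c%:num).
have q0 : 0 <= q by rewrite subr_ge0 ler_pdivrMr// mul1r lerD2l lerN2.
have q1 : q <= 1 by rewrite /q gerBl divr_ge0 ?subr_ge0 ?le1 ?ltW.
have aE : 1 - a%:num = (1 - c%:num) * (1 - q).
  by rewrite /q; field; rewrite gt_eqF.
by rewrite -(@convA _ _ c (Itv01 q0 q1) b a) ?convmm//= mulrC.
Qed.

Lemma open_bary_scale a U : open U -> open [set x | U (a '.: x)].
Proof. by apply: open_comp => x _; exact: conv_continuous_l. Qed.

(** Replacing the least point by x in x <| a |> 'bot can only go up, and
    x <| a |> x is x. *)
Lemma bary_scale_le a x U : open U -> U (a '.: x) -> U x.
Proof.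
move=> oU Uax; rewrite -(convmm a x).
have := @bary_bot_le _ _ x [set y | U (x <| a |> y)]; apply=> //.
by apply: open_comp oU => y _; exact: conv_continuous_r.
Qed.

Lemma open_botT U : open U -> U 'bot -> U = setT.
Proof.
move=> oU Ub; apply/seteqP; split=> // x _.
exact: (@bary_bot_le _ _ x U).
Qed.

(** The coefficients a with a x in U form a neighborhood of 1. *)
Lemma bary_scale_shrink x U :
  open U -> U x -> exists2 a, a%:num < 1 & U (a '.: x).
Proof.
move=> oU Ux.
have /continuousP/(_ U oU)[W oW WU] := @conv_continuous_coef R B x 'bot.
have mem a : W a%:num <-> U (a '.: x).
  by rewrite -[W _]/(((fun a : {i01 R} => a%:num) @^-1` W) a) WU.
have W1 : W 1 by apply/(mem 1%:i01); rewrite bary_scale1.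
have /nbhs_ballP[e /= e0 eW] : nbhs (1 : R) W by apply: open_nbhs_nbhs.
pose d := Num.min (e / 2) 1.
have d0 : 0 < d by rewrite lt_min ltr01 andbT divr_gt0.
have d1 : d <= 1 by rewrite ge_min lexx orbT.
have q0 : 0 <= 1 - d by rewrite subr_ge0.
have q1 : 1 - d <= 1 by rewrite gerBl ltW.
exists (Itv01 q0 q1) => /=; first by rewrite gtrBl.
apply/mem/eW; rewrite /ball /= opprB addrC subrK gtr0_norm//.
rewrite (le_lt_trans (_ : d <= e / 2))// ?ge_min ?lexx//.
by rewrite ltr_pdivrMr// ltr_pMr// ltr1n.
Qed.

End Dilations.

(** * Towers of opens and the telescope *)

Section Towers.
Context (R : realType) (B : pointedSemitopBaryType R) (alpha : {i01 R}).
Local Notation "a '.: x" := (bary_scale B a x) (at level 40).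

(** A tower is a saturated open set of the coproduct of countably many copies of
    B, i.e. an open set of the telescope: V n is its trace on the n-th copy. *)
Definition tower (V : nat -> set B) : Prop :=
  (forall n, open (V n)) /\ forall n x, V n x <-> V n.+1 (alpha '.: x).

(** Fullness of the dilation lets every open set of one copy be continued to the
    next copy; a choice of continuations is iterated. *)
Lemma full_tower (U : set B) :
  full (bary_scale B alpha) -> open U -> exists2 V, tower V & V 0%N = U.
Proof.
move=> af oU.
have /choice[phi phiP] : forall W : set B, exists W' : set B, open W ->
    open W' /\ W = bary_scale B alpha @^-1` W'.
  move=> W; have [/af[W' oW' ->]|nW] := pselect (open W).
    by exists W'.
  by exists set0.
have oV n : open (iter n phi U) by elim: n => //= n /phiP[].
exists (fun n => iter n phi U) => //; split=> // n x.
by rewrite {1}(phiP _ (oV n)).2.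
Qed.

Lemma tower_add V n k x : tower V ->
  V n x <-> V (n + k)%N (iter k (bary_scale B alpha) x).
Proof.
move=> [_ Vt]; elim: k => [|k IHk]; first by rewrite addn0.
by rewrite IHk addnS iterS; exact: Vt.
Qed.

Lemma tscope_class_step n x :
  tscope_class alpha (existT _ n x) =
  tscope_class alpha (existT _ n.+1 (alpha '.: x)).
Proof. by apply/eqmodP/asboolP; exact: tscope_step. Qed.

(** Membership in a tower is invariant under the generating steps of the
    equivalence, so it may be tested on representatives. *)
Lemma tower_open V : tower V -> exists2 W : set (tscope B alpha), open W &
  forall n x, W (tscope_class alpha (existT _ n x)) <-> V n x.
Proof.
move=> [oV Vt].
pose P (u : tscope_pre B) := V (projT1 u) (projT2 u).
have PE u v : tscope_equiv alpha u v -> P u <-> P v.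
  elim=> [n x|w|w w' _|w w' w'' _ IH1 _ IH2].
  - exact: Vt.
  - by [].
  - by move=> ->.
  - by rewrite IH1.
have WE n x : P (repr (tscope_class alpha (existT _ n x))) <-> V n x.
  have /eqmodP/asboolP/PE : repr (tscope_class alpha (existT _ n x)) =
    existT _ n x %[mod {eq_quot tscope_equiv_rel B alpha}] by rewrite reprK.
  by [].
exists [set q | P (repr q)] => //.
apply/open_slice => n.
by rewrite (_ : [set x | _] = V n)//; apply/seteqP; split=> x /WE.
Qed.

Lemma eta_continuous : continuous (eta B alpha).
Proof. by apply/continuousP => W /open_slice/(_ 0%N). Qed.

(** Every open set of B is the base of a tower, which gives fullness. It also
    separates the points that a T0 space distinguishes, which gives injectivity
    without a description of the generated equivalence. *)
Lemma eta_embedding : kolmogorov_space B -> full (bary_scale B alpha) ->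
  topological_embedding (eta B alpha).
Proof.
move=> T0 af.
have etaP U : open U -> exists2 W, open W & forall x, W (eta B alpha x) <-> U x.
  move=> /(full_tower af)[V /tower_open[W oW WV] <-].
  by exists W => // x; exact: WV.
split; [|move=> U /etaP[W oW WU]|exact: eta_continuous].
  move=> x y xy; apply: T0_eq => // U /etaP[W _ WU].
  by rewrite -!WU xy.
by exists W => //; apply/seteqP; split=> x /WU.
Qed.

(** If U is the trace on the copy 0 of an open set of the telescope, then the
    trace on the copy 1 is an open set of which U is the inverse image. *)
Lemma full_eta : full (eta B alpha) -> full (bary_scale B alpha).
Proof.
move=> ef U /ef[W oW ->].
exists [set x | W (tscope_class alpha (existT _ 1%N x))].
  by have /open_slice := oW; apply.
by apply/seteqP; split=> x; rewrite /preimage /= -tscope_class_step.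
Qed.

End Towers.

(** * The gauge of a tower *)

Section Gauge.
Context (R : realType) (B : pointedSemitopBaryType R) (alpha : {i01 R}).
Context (alpha01 : 0 < alpha%:num < 1).
Context (V : nat -> set B) (Vt : tower alpha V).
Local Notation "a '.: x" := (bary_scale B a x) (at level 40).

(** This is the set of the x such that r x belongs to the open set of the
    telescope defined by V. As r may exceed 1, r x is only available in a copy n
    with alpha ^ n r <= 1, where it is represented by (alpha ^ n r) x. *)
Definition level (r : R) : set B :=
  [set x | exists n (c : {i01 R}),
    c%:num = alpha%:num ^+ n * r /\ V n (c '.: x)].

Lemma alpha_pow (r : R) : 0 <= r -> exists n, alpha%:num ^+ n * r <= 1.
Proof.
move=> r0; have [a0 a1] := andP alpha01.
pose d := 1 - alpha%:num; have d0 : 0 < d by rewrite subr_gt0.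
(* with alpha = 1 - d, the product (1 - d) (1 + n d + d) is at most 1 + n d *)
have bernoulli n : alpha%:num ^+ n * (1 + d *+ n) <= 1.
  elim: n => [|n IHn]; first by rewrite mulr0n addr0 mulr1.
  apply: le_trans IHn; rewrite exprSr -mulrA ler_wpM2l ?exprn_ge0//.
  have -> : alpha%:num = 1 - d by rewrite /d subKr.
  rewrite mulrSr -subr_ge0; set m := d *+ n.
  have m0 : 0 <= m by rewrite mulrn_wge0// ltW.
  by nra.
exists (Num.bound (r / d)); apply: le_trans (bernoulli (Num.bound (r / d))).
rewrite ler_wpM2l ?exprn_ge0// -mulr_natr.
have /ltW : r / d < (Num.bound (r / d))%:R.
  by apply: archi_boundP; rewrite divr_ge0// ltW.
by rewrite ler_pdivrMr// mulrC => /le_trans; apply; rewrite lerDr.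
Qed.

Lemma iter_bary_scale k (c : {i01 R}) x : exists2 d : {i01 R},
  d%:num = alpha%:num ^+ k * c%:num &
  iter k (bary_scale B alpha) (c '.: x) = d '.: x.
Proof.
elim: k => [|k [d dE IH]]; first by exists c; rewrite // expr0 mul1r.
have q0 : 0 <= alpha%:num * d%:num by rewrite mulr_ge0.
have q1 : alpha%:num * d%:num <= 1 by rewrite mulr_ile1.
exists (Itv01 q0 q1) => /=; first by rewrite dE exprS mulrA.
by rewrite IH; exact: bary_scaleM.
Qed.

(** Representatives of r x in two copies n and m are compared in the copy
    n + m. *)
Lemma level_scale (r : R) n (c : {i01 R}) x : c%:num = alpha%:num ^+ n * r ->
  level r x <-> V n (c '.: x).
Proof.
move=> cE; split=> [|Vc]; last by exists n, c.
move=> [m [d [dE Vd]]].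
apply/(tower_add n m _ Vt); move: Vd => /(tower_add m n _ Vt).
have [c' c'E ->] := iter_bary_scale m c x.
have [d' d'E ->] := iter_bary_scale n d x.
rewrite addnC (_ : d' = c')//; apply/val_inj => /=.
by rewrite c'E d'E cE dE !mulrA -!exprD addnC.
Qed.

Lemma level_open r : open (level r).
Proof.
rewrite (_ : level r = \bigcup_(nc in [set nc : nat * {i01 R} |
    nc.2%:num = alpha%:num ^+ nc.1 * r]) [set x | V nc.1 (nc.2 '.: x)]).
  by apply: bigcup_open => -[n c] _; apply: open_bary_scale; exact: Vt.1.
apply/seteqP; split=> x; first by move=> [n [c [cE Vc]]]; exists (n, c).
by move=> [[n c] /= cE Vc]; exists n, c.
Qed.

Lemma level1 : level 1 = V 0%N.
Proof.
apply/seteqP; split=> x;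
  by rewrite (@level_scale _ 0%N 1%:i01) ?bary_scale1//= mulr1.
Qed.

Lemma levelM (r : R) (a : {i01 R}) x : 0 <= r ->
  level (a%:num * r) x <-> level r (a '.: x).
Proof.
move=> r0; have [n nr] := alpha_pow r0.
have q0 : 0 <= alpha%:num ^+ n * r by rewrite mulr_ge0 ?exprn_ge0.
pose c := Itv01 q0 nr.
have p0 : 0 <= c%:num * a%:num by rewrite mulr_ge0.
have p1 : c%:num * a%:num <= 1 by rewrite mulr_ile1.
rewrite (@level_scale r n c)// (@level_scale _ n (Itv01 p0 p1))/=; last first.
  by rewrite -mulrA (mulrC r).
by rewrite (@bary_scaleM _ _ c a (Itv01 p0 p1)).
Qed.

Lemma level_homo (r s : R) : 0 <= r <= s -> level r `<=` level s.
Proof.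
move=> /andP[r0 rs] x; have [s0|s0] := ltP 0 s; last first.
  by rewrite (_ : s = r)//; apply/le_anti; rewrite rs andbT (le_trans s0).
have q0 : 0 <= r / s by rewrite divr_ge0// ltW.
have q1 : r / s <= 1 by rewrite ler_pdivrMr// mul1r.
rewrite (_ : r = (Itv01 q0 q1)%:num * s); last by rewrite /= mulfVK ?gt_eqF.
by rewrite levelM ?ltW//; apply: bary_scale_le; exact: level_open.
Qed.

Context (V0T : V 0%N <> setT).

(** An open set containing 0 x, which is least, is everything. *)
Lemma level0 : level 0 = set0.
Proof.
apply/seteqP; split=> // x; rewrite (@level_scale _ 0%N 0%:i01) ?mulr0//.
by rewrite bary_scale0 => /(open_botT (Vt.1 0%N)).
Qed.

Lemma level_gt0 r x : 0 <= r -> level r x -> 0 < r.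
Proof. by rewrite le_eqVlt => /predU1P[<-|//]; rewrite level0. Qed.

Lemma level_shrink r x :
  0 <= r -> level r x -> exists2 s, 0 < s < r & level s x.
Proof.
move=> r0 rx; have r_gt0 := level_gt0 r0 rx.
have [a a1] := bary_scale_shrink (level_open r) rx.
rewrite -levelM// => ax; exists (a%:num * r) => //.
rewrite gtr_pMl// a1 andbT.
by apply: level_gt0 ax; rewrite mulr_ge0.
Qed.

(** This is the upper Minkowski functional of the open set given by the tower:
    the supremum of the t > 0 with x / t in that set. The index r stands for
    1 / t, and r = 0 contributes the value 0, since 0^-1 is 0. *)
Definition gauge_val (x : B) : \bar R :=
  ereal_sup [set (r^-1)%:E | r in [set r : R | 0 <= r /\ (r = 0 \/ level r x)]].

Lemma gauge_ge0 x : (0 <= gauge_val x)%E.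
Proof.
by apply: ereal_sup_ubound; exists 0; rewrite ?invr0//; split=> //; left.
Qed.

Definition gauge (x : B) : ERplus R := MkERplus (gauge_ge0 x).

(** A positive supremum is never attained, since a level containing x can
    be shrunk. This makes the strict superlevels of the gauge exactly the levels. *)
Lemma gauge_gt (c : R) x : 0 < c -> (c%:E < gauge x)%E <-> level c^-1 x.
Proof.
move=> c0; split.
  move=> /ereal_sup_gt[_ [r [r0 [->|rx]] <-]]; rewrite lte_fin.
    by rewrite invr0 ltNge ltW.
  move=> cr; apply: level_homo rx; rewrite r0 -[r]invrK lef_pV2 ?ltW//.
  by rewrite posrE (lt_trans c0).
move=> /level_shrink[|s /andP[s0 sc] sx]; first by rewrite invr_ge0 ltW.
apply: (@lt_le_trans _ _ (s^-1)%:E).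
  by rewrite lte_fin -[c]invrK ltf_pV2// posrE invr_gt0.
by apply: ereal_sup_ubound; exists s => //; split; [exact: ltW|right].
Qed.

Lemma gauge_continuous : continuous gauge.
Proof.
apply: continuous_ERplus => c c0.
rewrite (_ : [set x | _] = level c^-1); first exact: level_open.
by apply/seteqP; split=> x /(gauge_gt x c0).
Qed.

Lemma gauge_homogeneous : Ihomogeneous gauge.
Proof.
move=> a x; apply: ERplus_eq => c c0.
rewrite gauge_gt// -levelM ?invr_ge0 ?ltW//.
have [a0|a0] := eqVneq a%:num 0.
  by rewrite a0 mul0r level0 /= a0 mul0e lte_fin ltNge ltW.
have {}a0 : 0 < a%:num by rewrite lt_neqAle eq_sym a0 ge0.
rewrite /= -lte_pdivrMl// -EFinM gauge_gt ?mulr_gt0 ?invr_gt0//.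
by rewrite invfM invrK.
Qed.

Lemma gauge_superlevel : gauge @^-1` [set t | (1 < t :> \bar R)%E] = V 0%N.
Proof.
rewrite -level1; apply/seteqP.
by split=> x; [move=> /(gauge_gt x ltr01)|move=> ?; apply/(gauge_gt x ltr01)];
  rewrite invr1.
Qed.

End Gauge.

(** * The cone generated by a pointed barycentric algebra *)

Section Cone.
Context (R : realType) (B : pointedSemitopBaryType R).
Local Notation "'bot" := (@bary_bot R B).

(** The point (r, x) stands for the multiple r x, with r any nonnegative real.
    With these multiples, addition is a barycenter with normalized weights, and
    no common exponent has to be chosen as for the powers of alpha. *)
Definition cone_pre : Type := {r : Rplus R & B}.
HB.instance Definition _ := Topological.on cone_pre.
Implicit Types (u v w : cone_pre) (a c d r s : Rplus R).

Definition scaled (r : Rplus R) (x : B) : cone_pre := existT _ r x.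

Lemma weight_ge0 r s : 0 <= (r : R) / ((r : R) + (s : R)).
Proof. by rewrite divr_ge0 ?addr_ge0 ?Rplus_ge0. Qed.

Lemma weight_le1 r s : (r : R) / ((r : R) + (s : R)) <= 1.
Proof.
have : 0 <= (r : R) + (s : R) by rewrite addr_ge0 ?Rplus_ge0.
rewrite le_eqVlt => /predU1P[<-|rs]; first by rewrite invr0 mulr0.
by rewrite ler_pdivrMr// mul1r lerDl Rplus_ge0.
Qed.

Definition weight r s : {i01 R} := Itv01 (weight_ge0 r s) (weight_le1 r s).

Definition pre_add u v : cone_pre :=
  scaled (projT1 u + projT1 v)
    (projT2 u <| weight (projT1 u) (projT1 v) |> projT2 v).

Definition pre_scale a u : cone_pre := scaled (a * projT1 u) (projT2 u).

(** The multiples of the least point form a submonoid to be collapsed to 0.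
    Since (r, x) + (c, 'bot) is (r + c, (r / (r + c)) x), two multiples are
    identified when they agree at some common larger coefficient. *)
Definition pre_equiv u v : Prop :=
  exists c d, pre_add u (scaled c 'bot) = pre_add v (scaled d 'bot).

(** Normalized weights turn the quasi-associativity of barycenters into true
    associativity. *)
Lemma pre_addA : associative pre_add.
Proof.
move=> [r x] [s y] [t z]; rewrite /pre_add /=; congr scaled; first exact: addrA.
have := Rplus_ge0 r; have := Rplus_ge0 s; have := Rplus_ge0 t => t0 s0 r0.
apply: convA => /=.
  have [rs|rs] := eqVneq ((r : R) + (s : R)) 0.
    by rewrite (_ : (r : R) = 0) ?mul0r//; lra.
  by rewrite mulrA mulfVK// addrA.
have [st|st] := eqVneq ((s : R) + (t : R)) 0.
  have -> : (s : R) = 0 by lra.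
  have -> : (t : R) = 0 by lra.
  by rewrite /unstable.onem !addr0 mul0r subr0 mulr1.
have rst : (r : R) + ((s : R) + (t : R)) != 0.
  by rewrite gt_eqF// ltr_wpDl// lt_neqAle eq_sym st addr_ge0.
by rewrite /unstable.onem; field; rewrite -?addrA rst st.
Qed.

Lemma pre_add0 u : pre_add (scaled 0 'bot) u = u.
Proof.
case: u => r x; rewrite /pre_add /= add0r (_ : weight _ _ = 0%:i01) ?conv0//.
by apply/val_inj; rewrite /= mul0r.
Qed.

(** The condition excludes (0, x) and (0, y), for which the weight 0 / 0 breaks
    the symmetry. *)
Lemma pre_addC u v : projT1 u + projT1 v != 0 -> pre_add u v = pre_add v u.
Proof.
case: u v => [r x] [s y] /= rs; rewrite /pre_add /=.
congr scaled; [exact: addrC|rewrite convC; congr conv; apply/val_inj => /=].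
have {}rs : (r : R) + (s : R) != 0 := Rplus_neq0 rs.
by field; rewrite addrC.
Qed.

Lemma pre_add_bot c d :
  pre_add (scaled c 'bot) (scaled d 'bot) = scaled (c + d) 'bot.
Proof. by rewrite /pre_add /= convmm. Qed.

Lemma pre_equiv_refl u : pre_equiv u u. Proof. by exists 0, 0. Qed.

Lemma pre_equiv_sym u v : pre_equiv u v -> pre_equiv v u.
Proof. by move=> [c [d uv]]; exists d, c. Qed.

Lemma pre_equiv_trans v u w : pre_equiv u v -> pre_equiv v w -> pre_equiv u w.
Proof.
move=> [c [d uv]] [c' [d' vw]]; exists (c + c'), (d' + d).
rewrite -!pre_add_bot !pre_addA uv -vw -!pre_addA !pre_add_bot.
by rewrite [d + c']addrC.
Qed.

Lemma pre_equiv0 x y : pre_equiv (scaled 0 x) (scaled 0 y).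
Proof.
have w0 : weight 0 0 = 0%:i01 by apply/val_inj; rewrite /= mul0r.
by exists 0, 0; rewrite /pre_add /= w0 !conv0.
Qed.

Lemma pre_equivC u v : pre_equiv (pre_add u v) (pre_add v u).
Proof.
have [uv0|] := eqVneq (projT1 u + projT1 v) 0; last first.
  by move=> /pre_addC ->; exact: pre_equiv_refl.
by rewrite /pre_add uv0 addrC uv0; exact: pre_equiv0.
Qed.

Lemma pre_equiv_addl w u v :
  pre_equiv u v -> pre_equiv (pre_add w u) (pre_add w v).
Proof. by move=> [c [d uv]]; exists c, d; rewrite -!pre_addA uv. Qed.

(** The relation is visibly compatible with addition on the left, as it adds
    terms on the right; commutativity up to equivalence transfers this. *)
Lemma pre_equiv_add u u' v v' :
  pre_equiv u u' -> pre_equiv v v' ->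
  pre_equiv (pre_add u v) (pre_add u' v').
Proof.
move=> uu' vv'; apply: (pre_equiv_trans (v := pre_add u v')).
  exact: pre_equiv_addl.
apply: pre_equiv_trans (pre_equivC _ _) _.
apply: pre_equiv_trans (pre_equivC _ _).
exact: pre_equiv_addl.
Qed.

Lemma pre_scaleDr a u v : a != 0 ->
  pre_scale a (pre_add u v) = pre_add (pre_scale a u) (pre_scale a v).
Proof.
case: u v => [r x] [s y] a0; rewrite /pre_scale /pre_add /=.
congr scaled; [exact: mulrDr|congr conv; apply/val_inj => /=].
by rewrite -mulrDr invfM mulrACA divff ?mul1r// Rplus_neq0.
Qed.

Lemma pre_equiv_scale a u v :
  pre_equiv u v -> pre_equiv (pre_scale a u) (pre_scale a v).
Proof.
have [->|a0] := eqVneq a 0.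
  by rewrite /pre_scale !mul0r => _; exact: pre_equiv0.
move=> [c [d uv]]; exists (a * c), (a * d).
by have /(congr1 (pre_scale a)) := uv; rewrite !pre_scaleDr.
Qed.

Definition pre_eqb : rel cone_pre := fun u v => `[< pre_equiv u v >].

Lemma pre_eqb_refl : reflexive pre_eqb.
Proof. by move=> u; apply/asboolP; exact: pre_equiv_refl. Qed.

Lemma pre_eqb_sym : symmetric pre_eqb.
Proof. by move=> u v; apply/asboolP/asboolP; exact: pre_equiv_sym. Qed.

Lemma pre_eqb_trans : transitive pre_eqb.
Proof.
move=> v u w /asboolP uv /asboolP vw; apply/asboolP.
exact: pre_equiv_trans vw.
Qed.

Canonical pre_equiv_rel :=
  EquivRel pre_eqb pre_eqb_refl pre_eqb_sym pre_eqb_trans.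

Definition cone : Type := quotient_topology {eq_quot pre_equiv_rel}.
HB.instance Definition _ := Topological.on cone.
Implicit Types z : cone.

Definition cone_class u : cone :=
  \pi_(quotient_topology {eq_quot pre_equiv_rel}) u.

Definition cone_repr z : cone_pre := repr (z : {eq_quot pre_equiv_rel}).

Lemma cone_class_eq u v : cone_class u = cone_class v <-> pre_equiv u v.
Proof. by split=> [/eqmodP/asboolP|uv] //; apply/eqmodP/asboolP. Qed.

Lemma cone_reprK : cancel cone_repr cone_class. Proof. exact: reprK. Qed.

Lemma cone_repr_class u : pre_equiv (cone_repr (cone_class u)) u.
Proof. by apply/cone_class_eq; rewrite cone_reprK. Qed.

Lemma coneW (P : cone -> Prop) :
  (forall r x, P (cone_class (scaled r x))) -> forall z, P z.
Proof. by move=> cP z; rewrite -[z]cone_reprK; case: (cone_repr z). Qed.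

Definition cone_zero : cone := cone_class (scaled 0 'bot).
Definition cone_add z z' : cone :=
  cone_class (pre_add (cone_repr z) (cone_repr z')).
Definition cone_scale a z : cone := cone_class (pre_scale a (cone_repr z)).

Lemma cone_addE u v :
  cone_add (cone_class u) (cone_class v) = cone_class (pre_add u v).
Proof.
by apply/cone_class_eq; apply: pre_equiv_add; exact: cone_repr_class.
Qed.

Lemma cone_scaleE a u :
  cone_scale a (cone_class u) = cone_class (pre_scale a u).
Proof.
by apply/cone_class_eq; apply: pre_equiv_scale; exact: cone_repr_class.
Qed.

Let addA : associative cone_add.
Proof.
elim/coneW => r x; elim/coneW => s y; elim/coneW => t z.
by rewrite !cone_addE pre_addA.
Qed.
Let addC : commutative cone_add.
Proof.
elim/coneW => r x; elim/coneW => s y; rewrite !cone_addE.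
by apply/cone_class_eq; exact: pre_equivC.
Qed.
Let add0 : left_id cone_zero cone_add.
Proof. by elim/coneW => r x; rewrite cone_addE pre_add0. Qed.

HB.instance Definition _ := GRing.isNmodule.Build cone addA addC add0.

Let scaleA a b z : cone_scale a (cone_scale b z) = cone_scale (a * b) z.
Proof. by elim/coneW: z => r x; rewrite !cone_scaleE /pre_scale /= mulrA. Qed.
Let scale0 z : cone_scale 0 z = 0.
Proof.
elim/coneW: z => r x; rewrite cone_scaleE /pre_scale mul0r.
by apply/cone_class_eq; exact: pre_equiv0.
Qed.
Let scale1 : left_id 1 cone_scale.
Proof. by elim/coneW => r x; rewrite cone_scaleE /pre_scale mul1r. Qed.
Let scaleDr : right_distributive cone_scale +%R.
Proof.
move=> a; elim/coneW => r x; elim/coneW => s y.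
rewrite [_ + _]cone_addE !cone_scaleE [RHS]cone_addE; apply/cone_class_eq.
have [->|a0] := eqVneq a 0; last first.
  by rewrite pre_scaleDr//; exact: pre_equiv_refl.
by rewrite /pre_add /pre_scale /= !mul0r add0r; exact: pre_equiv0.
Qed.
Let scaleDl z : {morph cone_scale^~ z : a b / a + b}.
Proof.
move=> a b; elim/coneW: z => r x.
by rewrite !cone_scaleE [RHS]cone_addE /pre_add /pre_scale /= mulrDl convmm.
Qed.

HB.instance Definition _ := GRing.Nmodule_isLSemiModule.Build (Rplus R)
  cone scaleA scale0 scale1 scaleDr scaleDl.

Lemma cone_openP (U : set cone) :
  open U <-> forall r, open [set x : B | U (cone_class (scaled r x))].
Proof. exact: open_slice. Qed.

Lemma cone_addP r s x y : cone_class (scaled r x) + cone_class (scaled s y) =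
  cone_class (scaled (r + s) (x <| weight r s |> y)).
Proof. exact: cone_addE. Qed.

Lemma cone_scaleP a r x :
  a *: cone_class (scaled r x) = cone_class (scaled (a * r) x).
Proof. exact: cone_scaleE. Qed.

Lemma cone_class_bot c : cone_class (scaled c 'bot) = 0.
Proof. by apply/cone_class_eq; exists 0, c; rewrite !pre_add_bot addrC. Qed.

Lemma cone_class_scale r (a : {i01 R}) x :
  cone_class (scaled r (bary_scale B a x)) =
  cone_class (scaled (r * Rplus_of_i01 a) x).
Proof.
have [->|r0] := eqVneq r 0.
  by rewrite mul0r; apply/cone_class_eq; exact: pre_equiv0.
(* the missing mass (1 - a) r is supplied at the least point *)
rewrite -[RHS]addr0 -(cone_class_bot (r * Rplus_of_i01 (1 - a%:num)%:i01)).
rewrite cone_addP.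
congr (cone_class (scaled _ (_ <| _ |> _))); apply/val_inj => /=.
  by rewrite -mulrDr addrC subrK mulr1.
rewrite -mulrDr [a%:num + _]addrC subrK mulr1 mulrAC.
by rewrite divff ?mul1r// Rplus_neq0.
Qed.

Let add_continuous z : continuous (fun z' : cone => z + z').
Proof.
apply/continuousP => U /cone_openP oU; apply/cone_openP => s.
elim/coneW: z => r x.
under eq_set => y do rewrite /preimage /= cone_addP.
apply: open_comp (oU (r + s)) => y _; exact: conv_continuous_r.
Qed.

Let scale_continuous_r a : continuous (fun z : cone => a *: z).
Proof.
apply/continuousP => U /cone_openP oU; apply/cone_openP => r.
under eq_set => y do rewrite /preimage /= cone_scaleP.
exact: oU.
Qed.

(** An open set of the cone is upward closed on each ray because dilations
    decrease points, and it is open from below because x can be shrunk within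
    the slice through it. *)
Let scale_continuous_l z : continuous (fun a : Rplus R => a *: z).
Proof.
apply/continuousP => U /cone_openP oU; elim/coneW: z => r x.
rewrite /preimage; under eq_set => a do rewrite cone_scaleP.
apply: open_Rplus_upset => [|a b|a] /=.
- rewrite mul0r (_ : cone_class _ = 0); last first.
    by apply/cone_class_eq; exact: pre_equiv0.
  move=> U0; apply/seteqP; split=> // a _ /=.
  rewrite -[U _]/([set x | U (cone_class (scaled (a * r) x))] x).
  by rewrite (open_botT (oU (a * r)))//= cone_class_bot.
- move=> Ua ab; have [b0|b0] := eqVneq b 0.
    rewrite (_ : b = a)//; apply/val_inj/le_anti.
    by rewrite [X in _ && X]ab b0 Rplus_ge0.
  move: b0 => /Rplus_gt0 b0.
  have q0 : 0 <= (a : R) / (b : R) by rewrite divr_ge0 ?Rplus_ge0.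
  have q1 : (a : R) / (b : R) <= 1 by rewrite ler_pdivrMr// mul1r.
  apply: (bary_scale_le (oU (b * r)) (a := Itv01 q0 q1)) => /=.
  rewrite cone_class_scale.
  rewrite mulrAC (_ : b * _ = a)//; apply/val_inj => /=.
  by rewrite mulrC mulfVK// gt_eqF.
- move=> Ua /Rplus_gt0 a0.
  have [c c1 /=] := bary_scale_shrink (oU (a * r)) Ua.
  rewrite cone_class_scale mulrAC => Uc; exists (a * Rplus_of_i01 c) => //.
  by rewrite Rplus_ltE gtr_pMr.
Qed.

HB.instance Definition _ := isSemitopologicalCone.Build R cone
  add_continuous scale_continuous_l scale_continuous_r.

Definition unit_embed (x : B) : cone := cone_class (scaled 1 x).

Lemma unit_embed_continuous : continuous unit_embed.
Proof. by apply/continuousP => U /cone_openP/(_ 1). Qed.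

Lemma unit_embed_homogeneous : Ihomogeneous unit_embed.
Proof.
by move=> a x; rewrite /unit_embed cone_class_scale cone_scaleP mulrC.
Qed.

Lemma unit_embed_affine : affine_map unit_embed.
Proof.
move=> a x y; rewrite /unit_embed !cone_scaleP cone_addP !mulr1.
congr (cone_class (scaled _ (_ <| _ |> _))); apply/val_inj => /=.
  by rewrite addrC subrK.
by rewrite addrCA subrr addr0 invr1 mulr1.
Qed.

(** h extends to the cone by sending r x to r h(x), which homogeneity makes
    well defined; W is the superlevel of this extension at 1. *)
Lemma homogeneous_extension (h : B -> ERplus R) :
  Ihomogeneous h -> continuous h ->
  exists2 W : set cone, open W &
    forall x, W (unit_embed x) <-> (1 < h x :> \bar R)%E.
Proof.
move=> hh hc; pose g u := projT1 u *: h (projT2 u).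
have g_add_bot u c : g (pre_add u (scaled c 'bot)) = g u.
  case: u => r x; rewrite /g /=.
  have := hh (weight r c) x; rewrite /bary_scale => ->; rewrite scalerA.
  congr (_ *: _); apply/val_inj => /=.
  have [rc0|rc0] := eqVneq ((r : R) + (c : R)) 0.
    by rewrite rc0 mul0r; have := Rplus_ge0 r; have := Rplus_ge0 c; lra.
  by rewrite mulrCA divff// mulr1.
have g_equiv u v : pre_equiv u v -> g u = g v.
  by move=> [c [d uv]]; rewrite -(g_add_bot u c) uv g_add_bot.
have gE r x : g (cone_repr (cone_class (scaled r x))) = r *: h x.
  exact: g_equiv (cone_repr_class _).
exists [set z | (1 < g (cone_repr z) :> \bar R)%E]; last first.
  by move=> x; rewrite /unit_embed /mkset gE scale1r.
apply/cone_openP => r.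
rewrite (_ : [set x | _] = [set x | (1 < (r : R)%:E * h x)%E]); last first.
  by apply/seteqP; split=> x; rewrite /mkset gE.
have [r0|r0] := ltP 0 (r : R); last first.
  have -> : (r : R) = 0 by apply/le_anti; rewrite r0 Rplus_ge0.
  rewrite [X in open X](_ : _ = set0); first exact: open0.
  by apply/seteqP; split=> x //=; rewrite mul0e lte_fin ltr10.
under eq_set => x do rewrite -lte_pdivrMl// mule1.
by apply: open_superlevel; rewrite // invr_ge0 ltW.
Qed.

End Cone.

(** * The implications *)

Section Implications.
Context (R : realType) (B : pointedSemitopBaryType R).
Implicit Types (alpha : {i01 R}) (U : set B).

(** In a cone, dilation by alpha has the continuous inverse 1 / alpha. *)
Lemma strictly_embeddable_full alpha :
  0 < alpha%:num -> strictly_embeddable B -> full (bary_scale B alpha).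
Proof.
move=> a0 [C [f [[fh _] [_ ff fc]]]] U /ff[W oW ->].
have b0 : (alpha%:num)^-1 \is Num.nneg by rewrite nnegrE invr_ge0.
exists ((fun x => MkRplus b0 *: f x) @^-1` W).
  apply: (open_comp _ oW) => x _.
  by apply: continuous_comp; [exact: fc|exact: cone_scale_continuous_r].
have bK x : MkRplus b0 *: f (bary_scale B alpha x) = f x.
  rewrite fh scalerA (_ : _ * _ = 1) ?scale1r//; apply/val_inj => /=.
  by rewrite mulVf ?gt_eqF.
by apply/seteqP; split=> x; rewrite /preimage /= bK.
Qed.

(** A proper open set extends to a tower, and is the superlevel of its gauge;
    conversely a homogeneous map vanishes at the least point, which its
    superlevel at 1 therefore misses. *)
Lemma full_superlevels alpha : 0 < alpha%:num < 1 ->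
    full (bary_scale B alpha) ->
  [set U : set B | open U /\ U <> setT] = homogeneous_superlevels B.
Proof.
move=> a01 af; apply/seteqP; split=> U.
  move=> [/(full_tower af)[V Vt <-] V0].
  exists (gauge alpha V); last exact: gauge_superlevel.
  by split; [exact: gauge_homogeneous|exact: gauge_continuous].
move=> [h [hh hc] <-]; split; first exact: open_superlevel.
move=> /seteqP[_ /(_ (@bary_bot R B) I)] /=.
by rewrite -(bary_scale0 (@bary_bot R B)) hh /= mul0e lte_fin ltr10.
Qed.

Lemma proper_open_subbase (T : topologicalType) :
  is_subbase [set U : set T | open U /\ U <> setT].
Proof.
move=> U; split=> [oU|[G GF ->]]; last first.
  by apply: bigcup_open => V /GF; apply: finI_from_open => W [].
exists [set U]; last by rewrite bigcup_set1.
move=> _ ->; have [->|UT] := pselect (U = setT).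
  by exists fset0; rewrite // set_fset0 bigcap_set0.
exact: (@finI_from1 _ _ _ id).
Qed.

(** As h(alpha x) = alpha h(x), the superlevel of h at 1 is the inverse image
    under dilation of its superlevel at alpha. *)
Lemma superlevel_subbase_full alpha : 0 < alpha%:num ->
  is_subbase (homogeneous_superlevels B) -> full (bary_scale B alpha).
Proof.
move=> a0 /full_subbase; apply=> _ [h [hh hc] <-].
exists [set x | (alpha%:num%:E < h x :> \bar R)%E].
  exact: open_superlevel.
have e x : (alpha%:num%:E < h (bary_scale B alpha x) :> \bar R)%E =
    (1 < h x :> \bar R)%E by rewrite hh /= -lte_pdivrMl// -EFinM mulVf ?gt_eqF.
by apply/seteqP; split=> x; rewrite /preimage /= e.
Qed.

(** Homogeneous maps extend to the cone generated by B, so their superlevels are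
    traces of open sets of that cone. *)
Lemma superlevels_embeddable : kolmogorov_space B ->
  [set U : set B | open U /\ U <> setT] = homogeneous_superlevels B ->
  strictly_embeddable B.
Proof.
move=> T0 BE; exists (cone B), (@unit_embed R B).
have ext U : open U ->
    exists2 W, open W & U = @unit_embed R B @^-1` W.
  move=> oU; have [->|UT] := pselect (U = setT).
    by exists setT; [exact: openT|rewrite preimage_setT].
  have : homogeneous_superlevels B U by rewrite -BE.
  move=> [h [hh hc] <-]; have [W oW Wh] := homogeneous_extension hh hc.
  by exists W => //; apply/seteqP; split=> x /Wh.
split; first by split; [exact: unit_embed_homogeneous|exact: unit_embed_affine].
split=> //; last exact: unit_embed_continuous.
by move=> x y xy; apply: T0_eq => // U /ext[W _ ->]; rewrite /preimage /= xy.
Qed.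

End Implications.

Theorem proposition4p27 (R : realType) (B : pointedSemitopBaryType R)
    (B_T0 : kolmogorov_space B) :
  [<-> strictly_embeddable B;
       forall alpha : {i01 R}, 0 < alpha%:num < 1 ->
         topological_embedding (eta B alpha);
       exists2 alpha : {i01 R}, 0 < alpha%:num < 1 &
         topological_embedding (eta B alpha);
       [set U : set B | open U /\ U <> setT] = homogeneous_superlevels B;
       is_subbase (homogeneous_superlevels B);
       forall alpha : {i01 R}, 0 < alpha%:num < 1 ->
         full (bary_scale B alpha);
       exists2 alpha : {i01 R}, 0 < alpha%:num < 1 &
         full (bary_scale B alpha)].
Proof.
have half0 : 0 <= 2^-1 :> R by lra.
have half1 : 2^-1 <= 1 :> R by lra.
have half01 : 0 < (Itv01 half0 half1)%:num < 1 by apply/andP; split=> /=; lra.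
tfae.
- move=> Be alpha /andP[a0 _].
  by apply: eta_embedding => //; exact: strictly_embeddable_full.
- by move=> etaB; exists (Itv01 half0 half1) => //; exact: etaB.
- by move=> [alpha a01 [_ /full_eta af _]]; exact: full_superlevels af.
- by move=> <-; exact: proper_open_subbase.
- by move=> Bs alpha /andP[a0 _]; exact: superlevel_subbase_full.
- by move=> af; exists (Itv01 half0 half1) => //; exact: af.
- move=> [alpha a01 af].
  by apply: superlevels_embeddable => //; exact: full_superlevels af.
Qed.
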